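(* Let $n\ge 1$, $A=((a_1,b_1),\dots,(a_n,b_n))\in(\mathbb{N}^2)^n$ and $k\in\mathbb{N}$. Then $$N(A,k,q)=\sum_{p}\ \prod_{i=1}^{n-1}c\big(b_i,\ |a_{>i}|+|p_{>i}|,\ p_i\big),$$ where the sum is over all vectors $p=(p_1,\dots,p_{n-1})\in\mathbb{N}^{n-1}$ with $p_1+\cdots+p_{n-1}=k$ and $0\le p_i\le b_i$ for $1\le i\le n-1$.
   Context: $\mathbb{N}=\{0,1,2,\dots\}$. The $q$-meromorphic Weyl algebra is $MW_q=\mathbb{C}\langle x,y\rangle[q]/\langle yx-qxy-x^2\rangle$, where $\mathbb{C}\langle x,y\rangle[q]$ is the free associative complex algebra in the non-commuting variables $x,y$ with an adjoined formal variable $q$ that commutes with everything. The monomials $q^ix^jy^l$ ($i,j,l\in\mathbb{N}$) form a $\mathbb{C}$-basis of $MW_q$. For $a,b\in\mathbb{N}$ and $0\le k\le a$, the normal coordinates $c(a,b,k)\in\mathbb{N}[q]$ are defined by the identity in $MW_q$ $$y^ax^b=\sum_{k=0}^a c(a,b,k)x^{b+k}y^{a-k},$$ and $c(a,b,k)=0$ for $k>a$. For $A=((a_1,b_1),\dots,(a_n,b_n))$ write $|a|=a_1+\cdots+a_n$ and $|b|=b_1+\cdots+b_n$. The normal polynomials $N(A,k,q)\in\mathbb{N}[q]$ are defined by the identity in $MW_q$ $$\prod_{i=1}^n x^{a_i}y^{b_i}=x^{a_1}y^{b_1}x^{a_2}y^{b_2}\cdots x^{a_n}y^{b_n}=\sum_{k=0}^{|b|}N(A,k,q)x^{|a|+k}y^{|b|-k},$$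 and $N(A,k,q)=0$ for $k>|b|$. Finally $|a_{>i}|=a_{i+1}+\cdots+a_n$ and $|p_{>i}|=p_{i+1}+\cdots+p_{n-1}$ (an empty sum is $0$). *)

(* Defs.v *)
From HB Require Import structures.
From mathcomp Require Import all_boot all_order all_algebra.
From mathcomp Require Import boolp reals.
From mathcomp Require Import complex zify.
From mathcomp.multinomials Require Import monalg.

Set Implicit Arguments.
Unset Strict Implicit.
Unset Printing Implicit Defensive.
Import GRing.Theory.
Local Open Scope ring_scope.
Local Open Scope quotient_scope.

(* The free monoid on the alphabet T; the monoid algebra {malg K[word T]} is
   the free associative K-algebra on T. *)
Definition word (T : choiceType) := seq T.

Section FreeMonoid.
Variable T : choiceType.

HB.instance Definition _ := Choice.on (word T).

Lemma cat_eq_nil (u v : word T) : u ++ v = [::] -> u = [::] /\ v = [::].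
Proof. by case: u. Qed.

HB.instance Definition _ :=
  Choice_isMonomialDef.Build (word T) (@catA T) (@cat0s T) (@cats0 T)
    cat_eq_nil.

End FreeMonoid.

(* Quotient of a non-commutative ring by the two-sided ideal generated by r. *)
Section PrincipalQuotient.
Variables (A : nzRingType) (r : A).

Definition ideal_gen : {pred A} := fun f =>
  `[< exists s : seq (A * A), f = \sum_(uv <- s) uv.1 * r * uv.2 >].

Lemma ideal_genP f :
  reflect (exists s : seq (A * A), f = \sum_(uv <- s) uv.1 * r * uv.2)
          (f \in ideal_gen).
Proof. exact: asboolP. Qed.

Lemma ideal_gen_zmod_closed : zmod_closed ideal_gen.
Proof.
split=> [|f g /ideal_genP[s ->] /ideal_genP[t ->]]; apply/ideal_genP.
  by exists [::]; rewrite big_nil.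
exists (s ++ [seq (- uv.1, uv.2) | uv <- t]).
rewrite big_cat big_map /= -sumrN; congr (_ + _).
by apply: eq_bigr => uv _; rewrite !mulNr.
Qed.

HB.instance Definition _ := GRing.isZmodClosed.Build A ideal_gen
  ideal_gen_zmod_closed.

Lemma ideal_genMl u f : f \in ideal_gen -> u * f \in ideal_gen.
Proof.
move=> /ideal_genP[s ->]; apply/ideal_genP.
exists [seq (u * uv.1, uv.2) | uv <- s].
by rewrite big_map mulr_sumr; apply: eq_bigr => uv _; rewrite !mulrA.
Qed.

Lemma ideal_genMr u f : f \in ideal_gen -> f * u \in ideal_gen.
Proof.
move=> /ideal_genP[s ->]; apply/ideal_genP.
exists [seq (uv.1, uv.2 * u) | uv <- s].
by rewrite big_map mulr_suml; apply: eq_bigr => uv _; rewrite !mulrA.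
Qed.

Definition quot_gen := Quotient.quot ideal_gen.

HB.instance Definition _ := GRing.Zmodule.on quot_gen.
HB.instance Definition _ : EqQuotient A (Quotient.equiv ideal_gen) quot_gen :=
  EqQuotient.on quot_gen.

Definition quot_one : quot_gen := lift_cst quot_gen 1.
Definition quot_mul := lift_op2 quot_gen *%R.

Canonical pi_quot_one := PiConst quot_one.

Lemma pi_quot_mul : {morph \pi : x y / x * y >-> quot_mul x y}.
Proof.
move=> x y; unlock quot_mul; apply/eqP; rewrite piE Quotient.equivE.
rewrite -[_ * _](addrNK (x * repr (\pi_quot_gen y))) -mulrBr.
rewrite -addrA -mulrBl rpredD //.
  by apply: ideal_genMl; rewrite Quotient.idealrBE reprK.
by apply: ideal_genMr; rewrite Quotient.idealrBE reprK.
Qed.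
Canonical pi_quot_mul_morph := PiMorph2 pi_quot_mul.

Lemma quot_mulA : associative quot_mul.
Proof. by move=> x y z; rewrite -[x]reprK -[y]reprK -[z]reprK !piE mulrA. Qed.

Lemma quot_mul1l : left_id quot_one quot_mul.
Proof. by move=> x; rewrite -[x]reprK !piE mul1r. Qed.

Lemma quot_mul1r : right_id quot_one quot_mul.
Proof. by move=> x; rewrite -[x]reprK !piE mulr1. Qed.

Lemma quot_mulDl : left_distributive quot_mul +%R.
Proof.
move=> x y z; rewrite -[x]reprK -[y]reprK -[z]reprK.
by apply/eqP; rewrite piE /= mulrDl Quotient.equivE subrr rpred0.
Qed.

Lemma quot_mulDr : right_distributive quot_mul +%R.
Proof.
move=> x y z; rewrite -[x]reprK -[y]reprK -[z]reprK.
by apply/eqP; rewrite piE /= mulrDr Quotient.equivE subrr rpred0.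
Qed.

HB.instance Definition _ := GRing.Zmodule_isPzRing.Build quot_gen
  quot_mulA quot_mul1l quot_mul1r quot_mulDl quot_mulDr.

Definition quot_pi (f : A) : quot_gen := \pi_quot_gen f.

Lemma quot_pi_additive : zmod_morphism quot_pi.
Proof. by move=> x y; rewrite /quot_pi !piE. Qed.

HB.instance Definition _ := GRing.isZmodMorphism.Build A quot_gen quot_pi
  quot_pi_additive.

Lemma quot_pi_multiplicative : monoid_morphism quot_pi.
Proof. by split=> [|x y]; rewrite /quot_pi !piE. Qed.

HB.instance Definition _ := GRing.isMonoidMorphism.Build A quot_gen quot_pi
  quot_pi_multiplicative.

Lemma quot_piP f : reflect (quot_pi f = 0) (f \in ideal_gen).
Proof.
apply: (iffP idP) => [|/eqP]; rewrite -[f in f \in _]subr0 Quotient.idealrBE.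
  by move=> /eqP fE; rewrite /quot_pi fE piE.
by move=> h; rewrite -[X in _ == X]/(quot_pi 0) raddf0.
Qed.

End PrincipalQuotient.

Section NormalOrdering.
Variables (M : pzRingType) (cf : {rmorphism {poly nat} -> M}) (x y : M).
Hypothesis cf_xC : forall p, GRing.comm (cf p) x.
Hypothesis cf_yC : forall p, GRing.comm (cf p) y.
Hypothesis yxE : y * x = cf 'X * x * y + x ^+ 2.

Lemma yxX i : exists p, y * x ^+ i =
  cf 'X^i * x ^+ i * y + cf p * x ^+ i.+1.
Proof.
elim: i => [|i [p IH]].
  by exists 0; rewrite !expr0 rmorph1 rmorph0 !mul1r mulr1 mul0r addr0.
exists ('X^i + p).
have qxC : x ^+ i * cf 'X = cf 'X * x ^+ i.
  by apply/commr_sym/commrX/cf_xC.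
rewrite [in LHS]exprSr mulrA IH mulrDl -[_ * y * _]mulrA yxE mulrDr.
rewrite rmorphD mulrDl addrA /=; congr (_ + _ + _).
- rewrite -[cf 'X * _ * _]mulrA [LHS]mulrA -[_ * x ^+ i * cf 'X]mulrA qxC.
  rewrite [in RHS]exprSr rmorphM /= [in RHS]exprSr.
  by rewrite !mulrA.
- by rewrite -mulrA -exprD addn2.
- by rewrite -mulrA -exprSr.
Qed.

Definition expandable (m n : nat) (z : M) := exists f : nat -> {poly nat},
  z = \sum_(k < n.+1) cf (f k) * x ^+ (m + k) * y ^+ (n - k).

Lemma expandableD m n z t :
  expandable m n z -> expandable m n t -> expandable m n (z + t).
Proof.
move=> [f ->] [g ->]; exists (fun k => f k + g k).
by rewrite -big_split /=; apply: eq_bigr => k _; rewrite rmorphD !mulrDl.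
Qed.

Lemma expandable_coef m n p z :
  expandable m n z -> expandable m n (cf p * z).
Proof.
move=> [f ->]; exists (fun k => p * f k).
by rewrite mulr_sumr; apply: eq_bigr => k _; rewrite rmorphM !mulrA.
Qed.

Lemma expandable_monomial m n k : (k <= n)%N ->
  expandable m n (x ^+ (m + k) * y ^+ (n - k)).
Proof.
move=> le_kn; exists (fun i => (i == k)%:R).
have lt_kn : (k < n.+1)%N by [].
rewrite (bigD1 (Ordinal lt_kn)) //= eqxx rmorph1 mul1r big1 ?addr0 // => i.
by rewrite -val_eqE /= => /negPf ->; rewrite rmorph0 !mul0r.
Qed.

Lemma expandable_ind m n m' n' z (g : M -> M) :
    {morph g : u v / u + v} -> g 0 = 0 ->
    (forall p u, g (cf p * u) = cf p * g u) ->
    (forall k, (k <= n)%N ->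
       expandable m' n' (g (x ^+ (m + k) * y ^+ (n - k)))) ->
  expandable m n z -> expandable m' n' (g z).
Proof.
move=> gD g0 gZ gP [f ->]; rewrite (big_morph g gD g0).
elim/big_ind: _ => [|u v|k _]; last 1 first.
- by rewrite -mulrA gZ; apply/expandable_coef/gP; rewrite -ltnS.
- by exists (fun=> 0); rewrite big1 // => k _; rewrite rmorph0 !mul0r.
- exact: expandableD.
Qed.

Lemma expandable_mulx m n z : expandable m n z -> expandable m.+1 n (x * z).
Proof.
apply: (expandable_ind (g := fun z => x * z)) => [u v||p u|k le_kn].
- exact: mulrDr.
- exact: mulr0.
- by rewrite !mulrA cf_xC.
- by rewrite mulrA -exprS -addSn; apply: expandable_monomial.
Qed.

Lemma expandable_muly m n z : expandable m n z -> expandable m n.+1 (y * z).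
Proof.
apply: (expandable_ind (g := fun z => y * z)) => [u v||p u|k le_kn].
- exact: mulrDr.
- exact: mulr0.
- by rewrite !mulrA cf_yC.
have [p E] := yxX (m + k); rewrite mulrA E mulrDl.
apply: expandableD; rewrite -!mulrA; apply: expandable_coef.
  by rewrite -exprS -subSn //; apply: expandable_monomial; apply: leqW.
by rewrite -addnS -subSS; apply: expandable_monomial.
Qed.

Lemma expandable_mulX m n a b z :
  expandable m n z -> expandable (a + m) (b + n) (x ^+ a * y ^+ b * z).
Proof.
move=> zP; elim: a => [|a IH]; last first.
  by rewrite exprS -!mulrA [x ^+ a * _]mulrA; apply: expandable_mulx.
rewrite mul1r; elim: b => [|b IH]; first by rewrite mul1r.
by rewrite exprS -mulrA; apply: expandable_muly.
Qed.

Lemma expandable_x b : expandable b 0 (x ^+ b).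
Proof.
by have := @expandable_monomial b 0 0 isT; rewrite mulr1 addn0.
Qed.

End NormalOrdering.

Section MeromorphicWeyl.
Variable R : realType.

Local Notation C := (complex R).

(* C<x,y>[q]: the letters x and y are [false] and [true], and q is the
   polynomial variable, which commutes with every coefficient. *)
Definition free_xyq : nzRingType := {poly {malg C[word bool]}}.

Definition free_x : free_xyq := (<< ([:: false] : word bool) >>)%:P.
Definition free_y : free_xyq := (<< ([:: true] : word bool) >>)%:P.
Definition free_q : free_xyq := 'X.

Definition MW_rel : free_xyq :=
  free_y * free_x - free_q * free_x * free_y - free_x ^+ 2.

Definition MW : pzRingType := quot_gen MW_rel.

Definition MW_x : MW := quot_pi MW_rel free_x.
Definition MW_y : MW := quot_pi MW_rel free_y.
Definition MW_q : MW := quot_pi MW_rel free_q.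

(* The element p(q) of MW, for p with natural number coefficients. *)
Definition MW_coef (p : {poly nat}) : MW :=
  quot_pi MW_rel (map_poly (GRing.natmul 1) p : {poly {malg C[word bool]}}).

(* f k is the coordinate of z on x^(m + k) y^(n - k), extended by 0 to k > n; the
   term x^2 of the relation turns k letters y into letters x. *)
Definition normal_expansion (m n : nat) (z : MW)
    (f : nat -> {poly nat}) : Prop :=
  (forall k, (n < k)%N -> f k = 0) /\
  z = \sum_(k < n.+1) MW_coef (f k) * MW_x ^+ (m + k) * MW_y ^+ (n - k).

Lemma MW_yx : MW_y * MW_x = MW_q * MW_x * MW_y + MW_x ^+ 2.
Proof.
apply/eqP; rewrite -subr_eq0 opprD addrA; apply/eqP.
rewrite -!(rmorphM (quot_pi MW_rel)) -(rmorphXn (quot_pi MW_rel)).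
rewrite -!(rmorphB (quot_pi MW_rel)); apply/quot_piP/ideal_genP.
by exists [:: (1, 1)]; rewrite big_seq1 mul1r mulr1.
Qed.

Lemma MW_coef_is_nmod_morphism : nmod_morphism MW_coef.
Proof. by split=> [|p r]; rewrite /MW_coef ?rmorph0 // !rmorphD. Qed.

HB.instance Definition _ := GRing.isNmodMorphism.Build {poly nat} MW MW_coef
  MW_coef_is_nmod_morphism.

Lemma MW_coef_is_monoid_morphism : monoid_morphism MW_coef.
Proof. by split=> [|p r]; rewrite /MW_coef ?rmorph1 // !rmorphM. Qed.

HB.instance Definition _ := GRing.isMonoidMorphism.Build {poly nat} MW MW_coef
  MW_coef_is_monoid_morphism.

Lemma MW_coefX : MW_coef 'X = MW_q.
Proof. by rewrite /MW_coef map_polyX. Qed.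

Lemma map_nat_comm (B : nzRingType) (p : {poly nat}) (c : B) :
  GRing.comm (map_poly (GRing.natmul 1) p : {poly B}) c%:P.
Proof.
apply: commr_sym; elim/poly_ind: p => [|p n IH].
  by rewrite rmorph0; apply: commr0.
rewrite rmorphD rmorphM /= map_polyX map_polyC /=.
apply: commrD; last by rewrite rmorph_nat; apply: commr_nat.
by apply: commrM => //; apply: commr_polyX.
Qed.

Lemma MW_coef_xC p : GRing.comm (MW_coef p) MW_x.
Proof. by rewrite /GRing.comm -!(rmorphM (quot_pi MW_rel)) /= map_nat_comm. Qed.

Lemma MW_coef_yC p : GRing.comm (MW_coef p) MW_y.
Proof. by rewrite /GRing.comm -!(rmorphM (quot_pi MW_rel)) /= map_nat_comm. Qed.

Lemma expandable_expansion m n z :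
  expandable MW_coef MW_x MW_y m n z -> exists f, normal_expansion m n z f.
Proof.
move=> [f ->]; exists (fun k => if (n < k)%N then 0 else f k); split.
  by move=> k ->.
by apply: eq_bigr => k _; rewrite ltnNge -ltnS ltn_ord.
Qed.

Lemma MW_expandable_mulX m n a b z :
  expandable MW_coef MW_x MW_y m n z ->
  expandable MW_coef MW_x MW_y (a + m) (b + n) (MW_x ^+ a * MW_y ^+ b * z).
Proof.
apply: (expandable_mulX MW_coef_xC MW_coef_yC).
have := MW_yx; rewrite -MW_coefX; by apply.
Qed.

Lemma normal_coord_exists a b :
  exists f, normal_expansion b a (MW_y ^+ a * MW_x ^+ b) f.
Proof.
apply: expandable_expansion.
have := MW_expandable_mulX 0%N a (expandable_x MW_coef MW_x MW_y b).
by rewrite mul1r add0n addn0.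
Qed.

(* c(a, b, k) is normal_coord a b k; see normal_expansion_uniq below for
   uniqueness. *)
Definition normal_coord (a b : nat) : nat -> {poly nat} :=
  projT1 (cid (normal_coord_exists a b)).

Lemma normal_coordP a b :
  normal_expansion b a (MW_y ^+ a * MW_x ^+ b) (normal_coord a b).
Proof. exact: projT2 (cid (normal_coord_exists a b)). Qed.

Definition total_a n (A : n.-tuple (nat * nat)) : nat :=
  (\sum_(i < n) (tnth A i).1)%N.

Definition total_b n (A : n.-tuple (nat * nat)) : nat :=
  (\sum_(i < n) (tnth A i).2)%N.

Definition MW_word n (A : n.-tuple (nat * nat)) : MW :=
  \prod_(i < n) (MW_x ^+ (tnth A i).1 * MW_y ^+ (tnth A i).2).

Lemma normal_poly_exists n (A : n.-tuple (nat * nat)) :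
  exists f, normal_expansion (total_a A) (total_b A) (MW_word A) f.
Proof.
apply: expandable_expansion; rewrite /total_a /total_b /MW_word.
elim: n A => [|n IH] A.
  have := expandable_x MW_coef MW_x MW_y 0%N.
  by rewrite !big_ord0 expr0; apply.
have tE i : tnth A (lift ord0 i) = tnth [tuple of behead A] i.
  by rewrite tnth_behead; congr tnth; apply: val_inj; rewrite /= inordK ?ltnS.
rewrite !big_ord_recl; apply: MW_expandable_mulX.
have := IH [tuple of behead A].
under eq_bigr do rewrite -tE.
under [X in expandable _ _ _ _ X _]eq_bigr do rewrite -tE.
by under [X in expandable _ _ _ _ _ X]eq_bigr do rewrite -tE.
Qed.

(* N(A, k, q) is normal_poly A k. *)
Definition normal_poly n (A : n.-tuple (nat * nat)) : nat -> {poly nat} :=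
  projT1 (cid (normal_poly_exists A)).

Lemma normal_polyP n (A : n.-tuple (nat * nat)) :
  normal_expansion (total_a A) (total_b A) (MW_word A) (normal_poly A).
Proof. exact: projT2 (cid (normal_poly_exists A)). Qed.

End MeromorphicWeyl.

Section Representation.
Variables (R : realType) (B : nzRingType).

Local Notation C := (complex R).

Variables (sc : {rmorphism {poly C} -> B}) (letter : bool -> B).
Hypothesis scC : forall p u, GRing.comm (sc p) u.

Definition rep_word (w : word bool) : B := \prod_(c <- w) letter c.

Lemma rep_word_mmorphism : mmorphism rep_word.
Proof. by split=> [u v|]; rewrite /rep_word ?big_cat ?big_nil. Qed.

HB.instance Definition _ :=
  monalg.isMultiplicative.Build (word bool) B rep_word rep_word_mmorphism.

Definition rep_cst : C -> B := sc \o @polyC C.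

HB.instance Definition _ := GRing.RMorphism.on rep_cst.

Definition rep_free : {malg C[word bool]} -> B := mmap rep_cst rep_word.

HB.instance Definition _ := GRing.Additive.on rep_free.

Lemma rep_free_monoid_morphism : monoid_morphism rep_free.
Proof.
have [g m m'|h1 h2] := @commr_mmap_is_multiplicative _ _ _ rep_cst rep_word.
  exact: scC.
by split.
Qed.

HB.instance Definition _ :=
  GRing.isMonoidMorphism.Build _ _ rep_free rep_free_monoid_morphism.

Lemma rep_q_comm : commr_rmorph rep_free (sc 'X).
Proof. by move=> u; apply: scC. Qed.

Definition rep : {rmorphism free_xyq R -> B} := horner_morph rep_q_comm.

Lemma rep_gen c : rep (<< ([:: c] : word bool) >>)%:P = letter c.
Proof.
rewrite /rep /= horner_morphC /rep_free.
apply: etrans (@mmapU _ _ _ rep_cst rep_word 1 [:: c]) _.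
have -> : rep_word [:: c] = letter c by rewrite /rep_word big_seq1.
by apply: etrans (congr1 ( *%R^~ _) (rmorph1 rep_cst)) (mul1r _).
Qed.

Lemma rep_xE : rep (free_x R) = letter false. Proof. exact: rep_gen. Qed.
Lemma rep_yE : rep (free_y R) = letter true. Proof. exact: rep_gen. Qed.
Lemma rep_qE : rep (free_q R) = sc 'X. Proof. exact: horner_morphX. Qed.

Lemma rep_coef p : rep (map_poly (GRing.natmul 1) p) =
  sc (map_poly (GRing.natmul 1) p).
Proof.
elim/poly_ind: p => [|p n IH]; first by rewrite !rmorph0.
have mE (K : nzRingType) : map_poly (GRing.natmul 1) (p * 'X + n%:P) =
    map_poly (GRing.natmul 1) p * 'X + n%:R :> {poly K}.
  by rewrite rmorphD rmorphM /= map_polyX map_polyC /= rmorph_nat.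
rewrite !mE (rmorphD rep) (rmorphM rep) (rmorphD sc) (rmorphM sc) IH.
by rewrite (rmorph_nat rep) (rmorph_nat sc) -rep_qE.
Qed.

Hypothesis letter_rel : letter true * letter false =
  sc 'X * letter false * letter true + letter false ^+ 2.

Lemma rep_rel : rep (MW_rel R) = 0.
Proof.
rewrite /MW_rel; move: rep_xE rep_yE rep_qE letter_rel.
move: (free_x R) (free_y R) (free_q R) => x y q xE yE qE relE.
rewrite expr2 !(rmorphB rep) !(rmorphM rep) xE yE qE relE.
by rewrite addrAC expr2 addrK subrr.
Qed.

Lemma rep_ideal f : f \in ideal_gen (MW_rel R) -> rep f = 0.
Proof.
move=> /ideal_genP[s ->]; rewrite (rmorph_sum rep) big1 // => uv _.
by rewrite 2!(rmorphM rep) rep_rel mulr0 mul0r.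
Qed.

End Representation.

(* Uniqueness of normal expansions, from matrix representations of MW over
   C[q][z] in which x and y are subdiagonal. *)
Section Uniqueness.
Variables (R : realType) (d : nat).

Local Notation C := (complex R).
Local Notation S := {poly {poly C}}.
Local Notation E := 'M[S]_d.+1.

Definition rep_weight (i : nat) : S := iter i (fun u => 'X%:P * u + 1) 'X.

Lemma rep_weightS i : rep_weight i.+1 = 'X%:P * rep_weight i + 1.
Proof. by []. Qed.

Definition rep_letter (c : bool) : E :=
  \matrix_(i, j)
    if i == j.+1 :> nat then (if c then rep_weight j else 1) else 0.

Lemma rep_letterMS c (M : E) (i : nat) k : (i < d)%N ->
  (rep_letter c * M) (inord i.+1) k =
  (if c then rep_weight i else 1) * M (inord i) k.
Proof.
move=> lt_id; rewrite -mulmxE mxE (bigD1 (inord i)) //= mxE.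
rewrite !inordK // ?ltnS; last exact: ltnW.
rewrite eqxx big1 ?addr0 // => j; rewrite -val_eqE /= inordK; last exact: ltnW.
by rewrite mxE inordK ?ltnS // eqSS eq_sym => /negPf ->; rewrite mul0r.
Qed.

Lemma rep_letterM0 c (M : E) k : (rep_letter c * M) ord0 k = 0.
Proof. by rewrite -mulmxE mxE big1 // => j _; rewrite mxE mul0r. Qed.

Lemma rep_letterMM c c' (i k : 'I_d.+1) :
  (rep_letter c * rep_letter c') i k =
  if i == k.+2 :> nat then
    (if c then rep_weight k.+1 else 1) * (if c' then rep_weight k else 1)
  else 0.
Proof.
case: i => [[|i] lt_i].
  by rewrite (_ : Ordinal _ = ord0) ?rep_letterM0 //; apply: val_inj.
rewrite (_ : Ordinal _ = inord i.+1); last by apply: val_inj; rewrite /= inordK.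
rewrite rep_letterMS // mxE !inordK //; last exact: ltnW.
rewrite eqSS; case: eqP => [->|_] //; exact: mulr0.
Qed.

Lemma rep_letter_rel : rep_letter true * rep_letter false =
  ('X%:P)%:M * rep_letter false * rep_letter true + rep_letter false ^+ 2.
Proof.
have scE (M : E) : ('X%:P)%:M * M = 'X%:P *: M by exact: mul_scalar_mx.
apply/matrixP => i k; rewrite -[_%:M * _ * _]mulrA scE expr2.
rewrite rep_letterMM [RHS]mxE [X in _ = X + _]mxE !rep_letterMM.
case: (i == k.+2 :> nat); last by rewrite mulr0 addr0.
by rewrite mulr1 !mul1r rep_weightS.
Qed.

Lemma rep_monomial a j : (a + j <= d)%N ->
  (rep_letter false ^+ a * rep_letter true ^+ j) (inord (a + j)) ord0 =
  \prod_(t < j) rep_weight t.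
Proof.
elim: a => [|a IH] le_d; last first.
  by rewrite exprS -mulrA addSn rep_letterMS // mul1r IH // ltnW.
rewrite mul1r add0n; move: le_d; rewrite add0n.
elim: j => [|j IH] le_d; last first.
  by rewrite exprS rep_letterMS // IH 1?ltnW // big_ord_recr mulrC.
rewrite expr0 big_ord0 mxE (_ : inord 0 = ord0) //.
by apply: val_inj; rewrite /= inordK.
Qed.

Lemma rep_weight_size j : size (rep_weight j) = 2%N.
Proof.
elim: j => [|j IH]; first exact: size_polyX.
have sz : size ('X%:P * rep_weight j) = 2%N.
  by rewrite mul_polyC size_scale ?polyX_eq0.
by rewrite rep_weightS size_polyDl sz // size_poly1.
Qed.

Lemma rep_weight_indep n (g : nat -> {poly C}) :
  \sum_(j < n) (g j)%:P * \prod_(t < j) rep_weight t = 0 ->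
  forall j, (j < n)%N -> g j = 0.
Proof.
have sz j : size (\prod_(t < j) rep_weight t) = j.+1.
  rewrite size_prod => [|t _]; last by rewrite -size_poly_eq0 rep_weight_size.
  under eq_bigr do rewrite rep_weight_size.
  by rewrite sum_nat_const card_ord; lia.
elim: n => [|n IH] // E0 j.
have gn : g n = 0.
  have := congr1 (fun p : S => p`_n) E0; rewrite /= coef_sum coef0.
  rewrite big_ord_recr /= big1 => [|i _]; last first.
    by rewrite coefCM nth_default ?mulr0 // sz.
  rewrite add0r coefCM => /eqP; rewrite mulf_eq0 => /orP[/eqP //|].
  have -> : (\prod_(t < n) rep_weight t)`_n =
    lead_coef (\prod_(t < n) rep_weight t).
    by rewrite lead_coefE sz.
  by rewrite lead_coef_eq0 -size_poly_eq0 sz.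
rewrite ltnS leq_eqVlt => /orP[/eqP -> //|]; apply: IH.
by move: E0; rewrite big_ord_recr /= gn mul0r addr0.
Qed.

End Uniqueness.

Lemma scalar_poly_comm (R : realType) d (p : {poly complex R})
    (u : 'M[{poly {poly complex R}}]_d.+1) :
  GRing.comm (((@scalar_mx _ d.+1 \o polyC) : {rmorphism _ -> _}) p) u.
Proof. exact/commr_sym/comm_mx_scalar. Qed.

Lemma normal_expansion_uniq (R : realType) (m n : nat) (z : MW R) f g :
  normal_expansion m n z f -> normal_expansion m n z g -> f =1 g.
Proof.
move=> [f0 fE] [g0 gE] k; have [lt_nk|le_kn] := ltnP n k.
  by rewrite f0 ?g0.
pose mon k := free_x R ^+ (m + k) * free_y R ^+ (n - k).
pose cf (p : {poly nat}) : free_xyq R := map_poly (GRing.natmul 1) p.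
have: \sum_(k < n.+1) (cf (f k) - cf (g k)) * mon k \in ideal_gen (MW_rel R).
  apply/quot_piP; rewrite rmorph_sum; under eq_bigr do
    rewrite rmorphM rmorphB rmorphM !rmorphXn mulrBl !mulrA.
  by rewrite sumrB -[X in X - _]fE -[X in _ - X]gE subrr.
move=> /(rep_ideal (@scalar_poly_comm R (m + n))
  (rep_letter_rel R (m + n))) /matrixP /(_ (inord (m + n)) ord0).
set rho := rep _ _; rewrite (rmorph_sum rho) summxE mxE.
pose h j := map_poly (GRing.natmul 1) (f (n - j)%N) -
            map_poly (GRing.natmul 1) (g (n - j)%N) : {poly complex R}.
rewrite (reindex_inj rev_ord_inj) /=.
have mE (j : 'I_n.+1) : (rho
    ((cf (f (n.+1 - j.+1)%N) - cf (g (n.+1 - j.+1)%N)) * mon (n.+1 - j.+1)%N))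
    (inord (m + n)) ord0 = (h j)%:P * \prod_(t < j) rep_weight R t.
  have le_jn : (j <= n)%N by rewrite -ltnS.
  have -> : rho ((cf (f (n.+1 - j.+1)%N) - cf (g (n.+1 - j.+1)%N)) *
                 mon (n.+1 - j.+1)%N) = (h j)%:P%:M *
      (rep_letter R (m + n) false ^+ (m + (n - j)) *
       rep_letter R (m + n) true ^+ j).
    rewrite subSS (rmorphM rho) (rmorphB rho) /cf !rep_coef -!rmorphB.
    congr (_ * _); rewrite /mon (rmorphM rho) !(rmorphXn rho).
    by rewrite [rho (free_x R)]rep_xE [rho (free_y R)]rep_yE subKn.
  rewrite -[_%:M * _]/(_%:M *m _) mul_scalar_mx mxE; congr (_ * _).
  have := @rep_monomial R (m + n) (m + (n - j)) j.
  by rewrite -addnA subnK //; apply.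
under eq_bigr do rewrite mE.
move=> /rep_weight_indep /(_ (n - k)%N); rewrite ltnS leq_subr => /(_ isT) /eqP.
rewrite /h subKn // subr_eq0 => /eqP; apply: map_inj_poly => //.
by move=> a b /eqP; rewrite Num.Theory.eqr_nat => /eqP.
Qed.

(* Main.v *)
Require Import Defs.
From HB Require Import structures.
From mathcomp Require Import all_boot all_order all_algebra.
From mathcomp Require Import reals.
From mathcomp Require Import zify.

Set Implicit Arguments.
Unset Strict Implicit.
Unset Printing Implicit Defensive.
Import GRing.Theory.
Local Open Scope ring_scope.

(** Peel off the first block of the word.  If A' is A without its first pair
    (a, b), normally ordering the word of A' leaves
      x^a y^b \sum_j N(A', j) x^(|a'| + j) y^(|b'| - j),
    and the only factors still out of order are y^b x^(|a'| + j), whose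
    expansion has the coefficients c(b, |a'| + j, i).  The exponent of x grows
    by i + j in total, so, normal expansions being unique, comparing coordinates
    yields the convolution
      N(A, k) = \sum_(i <= min(k, b)) c(b, |a'| + (k - i), i) N(A', k - i),
    which is [normal_poly_cons].  Unfolding it down to a single block, where
    N((a, b), k) is 1 for k = 0 and 0 otherwise, produces the sum over vectors
    p: p_1 is the index i above, and j = k - i is the sum of the remaining
    entries, so that |a'| + j is the exponent |a_{>1}| + |p_{>1}| of the
    formula.  [big_ffun_ord_recl] performs the matching decomposition of the sum
    over p. *)

Lemma sum_antidiagonals (V : nmodType) (n b : nat) (G : nat -> nat -> nat -> V) :
    (forall i j k, (n < j)%N -> G i j k = 0) ->
  \sum_(i < b.+1) \sum_(j < n.+1) G i j (i + j)%N =
  \sum_(k < (b + n).+1) \sum_(i < k.+1 | (i <= b)%N) G i (k - i)%N k.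
Proof.
move=> G0.
transitivity (\sum_(i < b.+1)
    \sum_(k < (b + n).+1 | (i <= k)%N) G i (k - i)%N k).
  apply: eq_bigr => -[i /= lt_ib] _.
  rewrite -(big_mkord (fun k => (i <= k)%N) (fun k => G i (k - i)%N k)).
  rewrite (big_cat_nat (n := i)) //=; last by lia.
  rewrite [X in X + _]big_nat_cond [X in X + _]big1 ?add0r => [|k]; last by lia.
  (* Shifted by i, the range of k may exceed n; the excess terms vanish. *)
  rewrite -[X in index_iota X]add0n big_addn (big_cat_nat (n := n.+1)) //=;
    last by lia.
  rewrite [X in _ + X]big_nat_cond [X in _ + X]big1 ?addr0 => [|j jP].
    rewrite big_mkord; apply: eq_big => j; first by rewrite leq_addl.
    by rewrite addnK addnC.
  by apply: G0; rewrite addnK; lia.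
rewrite (exchange_big_dep xpredT) //=; apply: eq_bigr => k _.
rewrite (big_ord_widen_cond (b + n).+1 (fun i => (i <= b)%N)
  (fun i => G i (k - i)%N k)) //.
rewrite (big_ord_widen_cond (b + n).+1 (fun i => (i <= k)%N)
  (fun i => G i (k - i)%N k)) ?ltnS ?leq_addr //.
by apply: eq_bigl => i; rewrite andbC.
Qed.

Lemma sum_ord_recl_false m (F : 'I_m.+1 -> nat) (P : pred 'I_m.+1) :
    P ord0 = false ->
  (\sum_(i < m.+1 | P i) F i =
   \sum_(i < m | P (lift ord0 i)) F (lift ord0 i))%N.
Proof. by move=> P0; rewrite big_mkcond big_ord_recl P0 -big_mkcond. Qed.

Section FfunCons.
Variables (n : nat) (T : finType).

Definition ffun_cons (t : T) (p : {ffun 'I_n -> T}) : {ffun 'I_n.+1 -> T} :=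
  [ffun i => if unlift ord0 i is Some j then p j else t].

Lemma ffun_cons0 t p : ffun_cons t p ord0 = t.
Proof. by rewrite ffunE unlift_none. Qed.

Lemma ffun_consS t p i : ffun_cons t p (lift ord0 i) = p i.
Proof. by rewrite ffunE liftK. Qed.

Lemma big_ffun_ord_recl (V : nmodType) (P : pred {ffun 'I_n.+1 -> T})
    (F : {ffun 'I_n.+1 -> T} -> V) :
  \sum_(p | P p) F p =
  \sum_(t : T) \sum_(p | P (ffun_cons t p)) F (ffun_cons t p).
Proof.
rewrite pair_big_dep /=.
rewrite (reindex (fun u : T * {ffun 'I_n -> T} => ffun_cons u.1 u.2)) //=.
exists (fun p => (p ord0, [ffun i => p (lift ord0 i)])) => [[t p]|p] _ /=.
  rewrite ffun_cons0; congr pair.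
  by apply/ffunP => i; rewrite ffunE ffun_consS.
apply/ffunP => i; case: (unliftP ord0 i) => [j|] ->.
  by rewrite ffun_consS ffunE.
by rewrite ffun_cons0.
Qed.

End FfunCons.

Section Recurrence.
Variable R : realType.

(** The coefficients of z commute with x and y, so only y^b has to be moved past
    the powers x^(m + j) of the expansion of z; collecting the terms by the
    power of x puts the double sum in convolution form. *)
Lemma normal_expansion_mulX m n z f a b :
  normal_expansion (R := R) m n z f ->
  normal_expansion (a + m) (b + n) (MW_x R ^+ a * MW_y R ^+ b * z)
    (fun k => \sum_(i < k.+1 | (i <= b)%N)
                normal_coord R b (m + (k - i)) i * f (k - i)%N).
Proof.
move=> [f0 zE]; split=> [k lt_k|].
  by rewrite big1 // => i le_ib; rewrite f0 ?mulr0 //; lia.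
pose G i j k := MW_coef R (normal_coord R b (m + j) i * f j) *
  MW_x R ^+ (a + m + k) * MW_y R ^+ (b + n - k).
transitivity (\sum_(k < (b + n).+1) \sum_(i < k.+1 | (i <= b)%N)
    G i (k - i)%N k); last first.
  by apply: eq_bigr => k _; rewrite rmorph_sum !mulr_suml.
rewrite -sum_antidiagonals => [|i j k lt_nj]; last first.
  by rewrite /G f0 // mulr0 rmorph0 !mul0r.
rewrite zE mulr_sumr exchange_big /=; apply: eq_bigr => j _.
have le_jn : (j <= n)%N by rewrite -ltnS.
have xC p i : MW_coef R p * MW_x R ^+ i = MW_x R ^+ i * MW_coef R p.
  exact/commrX/MW_coef_xC.
have yC p i : MW_coef R p * MW_y R ^+ i = MW_y R ^+ i * MW_coef R p.
  exact/commrX/MW_coef_yC.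
rewrite -!mulrA [MW_y R ^+ b * _]mulrA -yC [_ * (MW_x R ^+ _ * _)]mulrA.
rewrite -[X in _ * (X * _)]mulrA (normal_coordP R b (m + j)).2.
rewrite mulr_sumr mulr_suml mulr_sumr; apply: eq_bigr => i _.
have le_ib : (i <= b)%N by rewrite -ltnS.
rewrite /G (_ : b + n - (i + j) = (b - i) + (n - j))%N; last by lia.
rewrite (_ : a + m + (i + j) = a + (m + j + i))%N; last by lia.
rewrite [MW_x R ^+ (a + _)]exprD [MW_y R ^+ (_ + _)]exprD.
rewrite (mulrC (normal_coord R b (m + j) i)) !mulrA; congr (_ * _ * _ * _).
by rewrite -[in LHS]mulrA -(rmorphM (MW_coef R)) xC.
Qed.

Lemma normal_poly1 (A : 1.-tuple (nat * nat)) k :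
  normal_poly R A k = (k == 0%N)%:R.
Proof.
pose f j : {poly nat} := (j == 0%N)%:R.
suff fP : normal_expansion (total_a A) (total_b A) (MW_word R A) f.
  exact: (normal_expansion_uniq (normal_polyP R A) fP).
split=> [[]//|].
rewrite /MW_word /total_a /total_b !big_ord1 big_ord_recl /= big1 => [|i _].
  by rewrite addr0 rmorph1 mul1r addn0 subn0.
by rewrite rmorph0 !mul0r.
Qed.

Lemma tnth_beheadE n (A : n.+1.-tuple (nat * nat)) (i : 'I_n) :
  tnth [tuple of behead A] i = tnth A (lift ord0 i).
Proof. by rewrite !(tnth_nth (0%N, 0%N)) nth_behead. Qed.

(** Both sides are the coordinates of the same word, by
    [normal_expansion_mulX] applied to the word without its first block. *)
Lemma normal_poly_cons n (A : n.+1.-tuple (nat * nat)) k :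
  let A' := [tuple of behead A] in let b := (tnth A ord0).2 in
  normal_poly R A k =
  \sum_(i < k.+1 | (i <= b)%N)
    normal_coord R b (total_a A' + (k - i)) i * normal_poly R A' (k - i).
Proof.
move=> A' b; set a := (tnth A ord0).1.
have aE : total_a A = (a + total_a A')%N.
  by rewrite /total_a big_ord_recl; under eq_bigr do rewrite -tnth_beheadE.
have bE : total_b A = (b + total_b A')%N.
  by rewrite /total_b big_ord_recl; under eq_bigr do rewrite -tnth_beheadE.
have wE : MW_word R A = MW_x R ^+ a * MW_y R ^+ b * MW_word R A'.
  by rewrite /MW_word big_ord_recl; under eq_bigr do rewrite -tnth_beheadE.
have := normal_polyP R A; rewrite aE bE wE => NA.
exact: normal_expansion_uniq NA (normal_expansion_mulX a b (normal_polyP R A')) k.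
Qed.

(** The entries of p are bounded by an M independent of k, since the
    induction on the number of blocks replaces k by k - p_1 while the type of
    the vectors has to stay the same. *)
Lemma normal_poly_sum n (A : n.+1.-tuple (nat * nat)) (M k : nat) :
  (k <= M)%N ->
  let a (j : 'I_n.+1) := (tnth A j).1 in
  let b (i : 'I_n) := (tnth A (widen_ord (leq_pred n.+1) i)).2 in
  normal_poly R A k =
  \sum_(p : {ffun 'I_n -> 'I_M.+1} |
          ((\sum_(i < n) p i)%N == k) && [forall i, (p i <= b i)%N])
    \prod_(i < n)
      normal_coord R (b i)
        (\sum_(j < n.+1 | i < j) a j + \sum_(j < n | i < j) p j)%N (p i).
Proof.
elim: n A k => [|n IH] A k le_kM a b.
  pose p0 : {ffun 'I_0 -> 'I_M.+1} := [ffun=> ord0].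
  have p0E p : p = p0 by apply/ffunP; case.
  rewrite normal_poly1 big_mkcond (bigD1 p0) //= [X in _ + X]big1 => [|p].
    rewrite addr0 !big_ord0 eq_sym (introT forallP) ?andbT => [|[]//].
    by case: eqP.
  by rewrite (p0E p) eqxx.
pose A' := [tuple of behead A].
have bE i : (tnth A' (widen_ord (leq_pred n.+1) i)).2 = b (lift ord0 i).
  by rewrite tnth_beheadE; congr (tnth A _).2; apply: val_inj.
have aE i : (tnth A' i).1 = a (lift ord0 i) by rewrite tnth_beheadE.
rewrite normal_poly_cons big_ffun_ord_recl.
have -> : tnth A ord0 = tnth A (widen_ord (leq_pred n.+2) ord0).
  by congr tnth; apply: val_inj.
rewrite -/(b ord0) -/A' (big_ord_widen_cond M.+1 (fun i => (i <= b ord0)%N)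
  (fun i => normal_coord R (b ord0) (total_a A' + (k - i)) i *
            normal_poly R A' (k - i))) //.
rewrite big_mkcond /=; apply: eq_bigr => t _.
have PE (p : {ffun 'I_n -> 'I_M.+1}) :
    ((\sum_(i < n.+1) ffun_cons t p i)%N == k) &&
      [forall i, (ffun_cons t p i <= b i)%N] =
    ((t <= b ord0)%N && (t < k.+1)%N) &&
    (((\sum_(i < n) p i)%N == (k - t)%N) &&
     [forall i, (p i <= b (lift ord0 i))%N]).
  rewrite big_ord_recl ffun_cons0; under eq_bigr do rewrite ffun_consS.
  rewrite (_ : [forall i, _] = (t <= b ord0)%N &&
    [forall i, (p i <= b (lift ord0 i))%N]); last first.
    apply/forallP/andP => [bP|[b0 /forallP bP] i].
      by split; [rewrite -(ffun_cons0 t p) |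
                 apply/forallP => i; rewrite -(ffun_consS t)].
    by case: (unliftP ord0 i) => [j|] ->; rewrite ?ffun_cons0 ?ffun_consS.
  by move: (\sum_(i < n) p i)%N [forall i, _] => s []; lia.
under eq_bigl do rewrite PE.
case: ifP => _; last by rewrite big_pred0.
rewrite IH ?(leq_trans (leq_subr _ _)) // mulr_sumr.
have bP (p : {ffun 'I_n -> 'I_M.+1}) :
    [forall i, (p i <= (tnth A' (widen_ord (leq_pred n.+1) i)).2)%N] =
    [forall i, (p i <= b (lift ord0 i))%N].
  by apply: eq_forallb => i; rewrite bE.
apply: eq_big => p; rewrite bP // => /andP[/eqP pk _].
rewrite big_ord_recl ffun_cons0; congr (_ * _); last first.
  apply: eq_bigr => i _; rewrite bE ffun_consS; congr normal_coord.
  rewrite !sum_ord_recl_false //.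
  by congr addn; apply: eq_bigr => j _; rewrite ?ffun_consS ?aE.
congr normal_coord; rewrite -pk.
congr addn; rewrite sum_ord_recl_false //;
  by apply: eq_bigr => i _; rewrite ?ffun_consS ?aE.
Qed.

End Recurrence.

Theorem theorem13 (R : realType) (n : nat) (n_ge1 : (1 <= n)%N)
    (A : n.-tuple (nat * nat)) (k : nat) :
  let a (j : 'I_n) := (tnth A j).1 in
  let b (i : 'I_n.-1) := (tnth A (widen_ord (leq_pred n) i)).2 in
  normal_poly R A k =
  \sum_(p : {ffun 'I_n.-1 -> 'I_k.+1} |
          ((\sum_(i < n.-1) p i)%N == k) && [forall i, (p i <= b i)%N])
    \prod_(i < n.-1)
      normal_coord R (b i)
        (\sum_(j < n | i < j) a j + \sum_(j < n.-1 | i < j) p j)%N (p i).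
Proof. by case: n n_ge1 A => // n _ A; apply: normal_poly_sum. Qed.
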